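(* Let $p$ be a prime, $n \geq 0$ an integer, and $P$ a nontrivial finite $p$-group of nilpotence class at most $n(p-1)+1$. Let $\mathcal{F}$ be a saturated fusion system on $P$ with $O_p(\mathcal{F}) = 1$. Then $Z(P)$ has exponent at most $p^n$.
   Context: A category on $P$ has as objects the subgroups of $P$, with $\mathrm{Hom}_{\mathcal F}(Q,R)$ a set of injective group homomorphisms $Q\to R$ such that every morphism is an $\mathcal F$-isomorphism followed by an inclusion. A saturated fusion system on $P$ is such a category containing all homomorphisms induced by conjugation by elements of $P$, in which $\mathrm{Aut}_P(P)$ is a Sylow $p$-subgroup of $\mathrm{Aut}_{\mathcal F}(P)$, and such that for every $\mathcal F$-isomorphism $\varphi: Q\to Q'$ with $Q'$ fully $\mathcal F$-normalized (i.e. $|N_P(Q')|\ge |N_P(Q'')|$ for all $Q''$ $\mathcal F$-isomorphic to $Q'$), $\varphi$ extends to an $\mathcal F$-morphism $N_\varphi\to P$, where $N_\varphi=\{x\in N_P(Q): \exists y\in N_P(\varphi(Q))\ \forall z\in Q,\ \varphi(xzx^{-1})=y\varphi(z)y^{-1}\}$. For $W\le P$, the normalizer $N_{\mathcal F}(W)$ is the category on $N_P(W)$ whose morphisms $R_1\to R_2$ are those $\mathcal F$-morphisms $\varphi$ admitting an extension $\tilde\varphi: WR_1\to WR_2$ in $\mathcal F$ with $\tilde\varphi(W)=W$. $W$ is normal in $\mathcal F$ if $\mathcal F = N_{\mathcal F}(W)$, and $O_p(\mathcal F)$ is the largest subgroup of $P$ normal in $\mathcal F$. *)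

(* Defs.v *)
From HB Require Import structures.
From mathcomp Require Import all_boot all_fingroup all_solvable.

Set Implicit Arguments.
Unset Strict Implicit.
Unset Printing Implicit Defensive.

Local Open Scope group_scope.

Section FusionSystems.

Variable gT : finGroupType.

(* A candidate morphism is a finite function gT -> gT; only its values on
   the source subgroup matter (see [fs_ext] below). *)
Notation hom := {ffun gT -> gT}.

(* A "category on P" is given by a boolean predicate
   [F Q R f] meaning "f (restricted to Q) belongs to Hom_F(Q, R)". *)
Definition fus_pred := {set gT} -> {set gT} -> hom -> bool.

Definition inj_hom (Q R : {set gT}) (f : hom) : Prop :=
  [/\ {in Q &, {morph f : x y / x * y}}, {in Q &, injective f}
    & f @: Q \subset R].

Definition comp_hom (g f : hom) : hom := [ffun x => g (f x)].
Definition conj_hom (x : gT) : hom := [ffun y => y ^ x].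

Definition fusion_system (P : {set gT}) (F : fus_pred) : Prop :=
  [/\
      forall Q R f, F Q R f ->
        [/\ group_set Q, group_set R, Q \subset P, R \subset P
          & inj_hom Q R f],
      forall Q R (f g : hom), F Q R f -> {in Q, f =1 g} -> F Q R g,
      forall (Q R : {group gT}) x, Q \subset P -> R \subset P -> x \in P ->
        Q :^ x \subset R -> F Q R (conj_hom x),
      forall Q R S (f g : hom), F Q R f -> F R S g -> F Q S (comp_hom g f)
    &
      forall Q R f, F Q R f ->
        F Q (f @: Q) f /\
        exists g, [/\ F (f @: Q) Q g, {in Q, cancel f g}
                    & {in f @: Q, cancel g f}]].

Definition F_iso (F : fus_pred) (Q R : {set gT}) : Prop :=
  exists f, F Q R f /\ f @: Q = R.

Definition AutF (F : fus_pred) (P : {set gT}) : {set {perm gT}} :=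
  [set a in Aut P | F P P [ffun x => a x]].

Definition AutP (P : {set gT}) : {set {perm gT}} :=
  [set a in Aut P | [exists x in P, [forall y in P, a y == y ^ x]]].

Definition fully_normalized (F : fus_pred) (P Q : {set gT}) : Prop :=
  forall Q'', F_iso F Q'' Q -> #|'N_P(Q'')| <= #|'N_P(Q)|.

(* N_phi, with the paper's convention c_x(z) = x z x^-1 = z ^ x^-1. *)
Definition N_phi (P Q : {set gT}) (f : hom) : {set gT} :=
  [set x in 'N_P(Q) | [exists y in 'N_P(f @: Q),
                        [forall z in Q, f (z ^ x^-1) == (f z) ^ y^-1]]].

Definition saturated (p : nat) (P : {set gT}) (F : fus_pred) : Prop :=
  [/\ fusion_system P F,
      p.-Sylow(AutF F P) (AutP P)
    & forall Q Q' f, F Q Q' f -> f @: Q = Q' -> fully_normalized F P Q' ->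
        exists g, F (N_phi P Q f) P g /\ {in Q, g =1 f}].

Definition normal_in_F (F : fus_pred) (P W : {set gT}) : Prop :=
  [/\ group_set W, W \subset P, P \subset 'N(W)
    & forall R1 R2 f, F R1 R2 f ->
        exists g, [/\ F (W * R1) (W * R2) g, {in R1, g =1 f} & g @: W = W]].

End FusionSystems.

(* Main.v *)
(** The subgroup W of p^n-th powers of Z(P) is shown to be normal in F, hence
    trivial, by extending every morphism Q -> P to WQ so that W is preserved, by
    downward induction on |Q|.  As in Alperin's fusion theorem this reduces to the
    automorphisms of a fully normalized Q < P; if C_P(Q) is not contained in Q, they
    all extend to Q C_P(Q).  Otherwise W lies in the subgroup V of p^n-th powers of
    Z(Q).  Take x in N_P(Q) outside Q with x^p in Q.  On Z(Q) we have x^p = 1 and,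
    by the bound on the class, (x - 1)^(n(p-1)+1) = 0, which force p^n (x - 1) = 0:
    thus x centralizes V.  So the kernel K of the action of Aut_F(Q) on V has a Sylow
    subgroup T larger than Inn(Q), and Aut_F(Q) = K N(T) by the Frattini argument,
    where K fixes W pointwise while elements of N(T) extend to a larger subgroup. *)

Require Import Defs.
From HB Require Import structures.
From mathcomp Require Import all_boot all_fingroup all_solvable.
From mathcomp Require Import ssralg zify.

Set Implicit Arguments.
Unset Strict Implicit.
Unset Printing Implicit Defensive.

Local Open Scope group_scope.

(** * Unipotent operators [1 + Y] whose p-th power is the identity *)

Section UnipotentAction.

Import GRing.Theory FiniteModule.
Local Open Scope ring_scope.

Lemma iter_unipotent (V : zmodType) (Y : {additive V -> V}) m u :
  iter m (fun v => v + Y v) u = \sum_(k < m.+1) iter k Y u *+ 'C(m, k).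
Proof.
elim: m => [|m IHm]; first by rewrite big_ord1.
rewrite iterS IHm raddf_sum /=.
under [X in _ + X]eq_bigr => k _ do rewrite raddfMn -iterS.
rewrite [RHS]big_ord_recl bin0 /=.
under [X in _ = _ + X]eq_bigr => k _ do rewrite /bump add1n binS mulrnDr.
rewrite big_split addrA /=; congr (_ + _).
(* Shift the index: the extra top term, with coefficient ['C(m, m.+1)], is zero. *)
have := @big_ord_recl V 0 +%R m.+1 (fun k : 'I_m.+2 => iter k Y u *+ 'C(m, k)).
by rewrite big_ord_recr /= bin_small // mulr0n addr0 bin0 => ->.
Qed.

(* Expanding [X^p = 1] with [X = 1 + Y] expresses [p Y] through [Y^p] and the
   [p Y^k] with [k > 1]; hence [p^i Y^j] dies as soon as its weight
   [i (p - 1) + j] reaches the nilpotence index of [Y]. *)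
Lemma unipotent_order_p (V : zmodType) (Y : {additive V -> V}) p n u :
    prime p -> (forall v, iter p (fun w => w + Y w) v = v) ->
    (forall v, iter (n * (p - 1) + 1) Y v = 0) ->
  Y u *+ p ^ n = 0.
Proof.
move=> p_pr Xp Yc; have p_gt1 := prime_gt1 p_pr.
set c := (n * (p - 1) + 1)%N in Yc.
have Ybig j v : (c <= j)%N -> iter j Y v = 0.
  by move=> le_cj; rewrite -(subnKC le_cj) iterD Yc.
have pY v : Y v *+ p =
    - (\sum_(2 <= k < p) iter k Y v *+ 'C(p, k)) - iter p Y v.
  have := Xp v; rewrite iter_unipotent.
  rewrite -(big_mkord xpredT (fun k => iter k Y v *+ 'C(p, k))).
  rewrite big_ltn // big_nat_recr ?prime_gt0 //= big_ltn // bin0 bin1 binn !mulr1n.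
  move/(canRL (addKr _)); rewrite addNr -addrA => /eqP.
  by rewrite addr_eq0 opprD => /eqP.
suff wt i : forall j, (c <= i * (p - 1) + j.+1)%N -> iter j.+1 Y u *+ p ^ i = 0.
  by apply: (wt n 0%N); rewrite /c.
elim: i => [|i IHi] j wt_ij; first by rewrite Ybig.
(* Inner induction, downward on [j]: when one [p Y] in [p^(i+1) Y^(j+1)] is rewritten, the term
   [Y^p] keeps the weight and lowers [i], while the others keep [p^(i+1)] and raise [j]. *)
have [d] := ubnP (c - j.+1)%N; elim: d j wt_ij => // d IHd j wt_ij lt_d.
have [le_cj | lt_jc] := leqP c j.+1; first by rewrite Ybig ?mul0rn.
rewrite iterS expnS mulrnA pY mulrnDl !mulNrn -iterD.
rewrite [iter (p + j) Y u *+ _](_ : _ = 0) ?subr0; last first.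
  have -> : (p + j = (p + j).-1.+1)%N by lia.
  by apply: IHi; move: wt_ij; rewrite mulSn; lia.
rewrite -sumrMnl big_nat_cond big1 ?oppr0 // => k /andP[/andP[k2 kp] _].
have /dvdnP[q ->] : (p %| 'C(p, k))%N by rewrite prime_dvd_bin ?kp ?(leq_trans _ k2).
rewrite -mulrnA -mulnA mulnC -iterD mulrnA -expnS.
have -> : (k + j = (k + j).-1.+1)%N by lia.
by rewrite IHd ?mul0rn //; lia.
Qed.

Local Close Scope ring_scope.

(** Written additively, [b |-> [~ b, x]] is the operator [Y = x - 1] on [A], and [x ^+ p] acts
    trivially, so [p^n Y = 0]. *)
Lemma cent_expn_of_iter_commg (gT : finGroupType) (p n : nat)
    (A : {group gT}) x :
    prime p -> abelian A -> x \in 'N(A) -> x ^+ p \in 'C(A) ->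
    {in A, forall a, iter (n * (p - 1) + 1) (fun b => [~ b, x]) a = 1} ->
  {in A, forall a, commute (a ^+ (p ^ n)) x}.
Proof.
move=> p_pr abA nAx cAxp unipA a Aa.
pose Yf (u : fmod_of abA) := (actr u x - u)%R.
have addY : zmod_morphism Yf.
  by move=> u v; rewrite /Yf actAr actNr !opprD !opprK addrACA.
pose Y : {additive _ -> _} := HB.pack Yf (GRing.isZmodMorphism.Build _ _ Yf addY).
have YE u : val (Y u) = [~ val u, x].
  by rewrite /Y /= /Yf addrC fmvalA fmvalN fmvalJ.
have Xp v : iter p (fun w => (w + Y w)%R) v = v.
  have XE w : (w + Y w = actr w x)%R by rewrite /Y /= /Yf addrC subrK.
  have -> m : iter m (fun w => (w + Y w)%R) v = actr v (x ^+ m).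
    elim: m => [|m IHm] /=; first by apply: val_inj; rewrite fmvalJ ?group1 ?conjg1.
    by apply: val_inj; rewrite IHm XE !fmvalJ ?groupX // expgSr conjgM.
  apply: val_inj; rewrite fmvalJ ?groupX //; apply/conjg_fixP/commgP.
  by apply: commute_sym; apply: (centP cAxp); apply: fmodP.
have Yc v : iter (n * (p - 1) + 1) Y v = 0%R.
  apply: val_inj; rewrite fmval0 -[RHS](unipA (val v)) ?fmodP //.
  by elim: (_ + _)%N => //= m <-; rewrite YE.
have /(congr1 val) := unipotent_order_p (fmod abA a) p_pr Xp Yc.
rewrite fmvalZ YE fmval0 fmodK // => comm_ax.
(* As [A] is abelian, [[~ a, x] ^+ (p ^ n)] is [[~ a ^+ (p ^ n), x]]. *)
apply/commgP/eqP; rewrite -{}comm_ax !commgEl conjXg -expgVn.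
have comm_ax : commute a^-1 (a ^ x).
  by apply: (centsP abA); rewrite ?groupV ?memJ_norm.
by rewrite (expgMn _ comm_ax).
Qed.

End UnipotentAction.

(** * Closure properties of fusion systems *)

Section FusionBasics.

Variables (gT : finGroupType) (P : {group gT}) (F : fus_pred gT).
Hypothesis fusF : fusion_system P F.
Implicit Types (Q R : {group gT}) (f g : {ffun gT -> gT}).

Lemma fus_sub_dom A B f : F A B f -> A \subset P.
Proof. by case: fusF => ax _ _ _ _ /ax[]. Qed.

Lemma fus_sub_cod A B f : F A B f -> B \subset P.
Proof. by case: fusF => ax _ _ _ _ /ax[]. Qed.

Lemma fus_hom A B f : F A B f -> inj_hom A B f.
Proof. by case: fusF => ax _ _ _ _ /ax[]. Qed.

Lemma fus_morph A B f : F A B f -> {in A &, {morph f : x y / x * y}}.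
Proof. by case/fus_hom. Qed.

Lemma fus_inj A B f : F A B f -> {in A &, injective f}.
Proof. by case/fus_hom. Qed.

Lemma fus_im A B f : F A B f -> f @: A \subset B.
Proof. by case/fus_hom. Qed.

Lemma card_fus_im A B f : F A B f -> #|f @: A| = #|A|.
Proof. by move/fus_inj/card_in_imset. Qed.

Lemma fus_mem A B f x : F A B f -> x \in A -> f x \in B.
Proof. by move/fus_im/subsetP=> sfB Ax; apply/sfB/imset_f. Qed.

Lemma fus_group_dom A B f : F A B f -> group_set A.
Proof. by case: fusF => ax _ _ _ _ /ax[]. Qed.

Lemma eq_fus A B f g : F A B f -> {in A, f =1 g} -> F A B g.
Proof. by case: fusF => _ ax _ _ _; apply: ax. Qed.

Lemma fus_comp A B C f g : F A B f -> F B C g -> F A C (comp_hom g f).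
Proof. by case: fusF => _ _ _ ax _; apply: ax. Qed.

Lemma fus_im_iso A B f : F A B f -> F A (f @: A) f.
Proof. by case: fusF => _ _ _ _ ax /ax[]. Qed.

Lemma fus_group_im A B f : F A B f -> group_set (f @: A).
Proof. by move/fus_im_iso; case: fusF => ax _ _ _ _ /ax[]. Qed.

Lemma fus_inv A B f : F A B f ->
  exists g, [/\ F (f @: A) A g, {in A, cancel f g} & {in f @: A, cancel g f}].
Proof. by case: fusF => _ _ _ _ ax /ax[]. Qed.

(** Inclusions are conjugations by 1; composing with them restricts sources and changes targets. *)
Lemma fus_incl Q R f :
  Q \subset R -> R \subset P -> {in Q, f =1 id} -> F Q R f.
Proof.
move=> sQR sRP idf; have sQP := subset_trans sQR sRP.
case: fusF => _ _ conjF _ _; apply: (eq_fus (conjF Q R 1 _ _ _ _)) => //.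
  by rewrite conjsg1.
by move=> x Qx; rewrite ffunE conjg1 idf.
Qed.

Lemma fus_restr Q (A B : {set gT}) f : Q \subset A -> F A B f -> F Q B f.
Proof.
move=> sQA FAB; have gA := fus_group_dom FAB.
pose i : {ffun gT -> gT} := [ffun x => x].
have FQA : F Q (Group gA) i.
  by apply: fus_incl => [||x _]; rewrite ?(fus_sub_dom FAB) // ffunE.
by apply: eq_fus (fus_comp FQA FAB) _ => x _; rewrite !ffunE.
Qed.

Lemma fus_cod (A B : {set gT}) R f :
  F A B f -> f @: A \subset R -> R \subset P -> F A R f.
Proof.
move=> FAB sfR sRP; pose i : {ffun gT -> gT} := [ffun x => x].
have FfR : F (Group (fus_group_im FAB)) R i.
  by apply: fus_incl => // x _; rewrite ffunE.
by apply: eq_fus (fus_comp (fus_im_iso FAB) FfR) _ => x _; rewrite !ffunE.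
Qed.

Lemma fus_codP A B f : F A B f -> F A P f.
Proof.
move=> FAB; apply: fus_cod (FAB) _ (subxx _).
exact: subset_trans (fus_im FAB) (fus_sub_cod FAB).
Qed.

Lemma fusJ Q B f : F Q B f -> {in Q &, forall x y, f (x ^ y) = f x ^ f y}.
Proof. by move=> FQB x y Qx Qy; apply: (morphJ (Morphism (fus_morph FQB))). Qed.

Lemma fus_norms Q R B f :
  Q \subset R -> R \subset 'N(Q) -> F R B f -> f @: R \subset 'N(f @: Q).
Proof.
move=> sQR nQR FRB; pose fm := Morphism (fus_morph FRB).
have := morphim_norms fm nQR.
by rewrite morphimEdom (morphimEsub fm).
Qed.

Lemma fus_iso_im A B f : F A B f -> F_iso F (f @: A) A.
Proof.
move=> FAB; have [g [FBA fK _]] := fus_inv FAB; exists g; split=> //.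
rewrite -imset_comp -[RHS]imset_id; apply: eq_in_imset => x Ax.
exact: fK.
Qed.

Lemma AutFP Q a : reflect (a \in Aut Q /\ F Q Q (finfun a)) (a \in AutF F Q).
Proof. by apply: (iffP setIdP). Qed.

Lemma AutF_sub_Aut Q : AutF F Q \subset Aut Q.
Proof. by apply/subsetP=> a /AutFP[]. Qed.

Lemma AutF_group_set Q : Q \subset P -> group_set (AutF F Q).
Proof.
move=> sQP; apply/group_setP; split=> [|a b /AutFP[Aa Fa] /AutFP[Ab Fb]].
  apply/AutFP; split; first exact: group1.
  by apply: fus_incl => // x _; rewrite ffunE perm1.
apply/AutFP; split; first exact: groupM.
by apply: eq_fus (fus_comp Fa Fb) _ => x _; rewrite !ffunE permM.
Qed.

Lemma AutF_of_fus Q B f :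
  F Q B f -> f @: Q \subset Q -> exists2 a, a \in AutF F Q & {in Q, a =1 f}.
Proof.
move=> FQB sfQ; have injf := fus_inj FQB.
exists (perm_in injf sfQ); last exact: perm_inE.
apply/AutFP; split; last first.
  apply: eq_fus (fus_cod FQB sfQ (fus_sub_dom FQB)) _ => x Qx.
  by rewrite ffunE perm_inE.
rewrite inE perm_in_on; apply/morphicP=> x y Qx Qy.
by rewrite !perm_inE ?groupM // (fus_morph FQB).
Qed.

Lemma AutF_mem Q a x : a \in AutF F Q -> (a x \in Q) = (x \in Q).
Proof. by case/AutFP=> /setIdP[/perm_closed aQ _] _. Qed.

Lemma AutP_sub_AutF Q : Q \subset P -> conj_aut Q @* 'N_P(Q) \subset AutF F Q.
Proof.
move=> sQP; apply/subsetP=> _ /morphimP[x nQx /setIP[Px _] ->].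
apply/AutFP; split; first exact: Aut_aut.
case: fusF => _ _ conjF _ _; apply: (eq_fus (conjF Q Q x sQP sQP Px _)).
  by rewrite (normP nQx).
by move=> y Qy; rewrite !ffunE norm_conj_autE.
Qed.

Lemma fully_normalized_exists Q : Q \subset P ->
  exists R : {group gT}, exists f,
    [/\ F Q R f, f @: Q = R & fully_normalized F P R].
Proof.
move=> sQP.
pose C := [pred A : {set gT} | [exists f, F Q A f && (f @: Q == A)]].
have CQ : C Q.
  apply/existsP; exists [ffun x => x]; rewrite fus_incl //=; last first.
    by move=> x _; rewrite ffunE.
  by rewrite (eq_imset _ (ffunE _)) imset_id.
case: (arg_maxnP (fun A : {set gT} => #|'N_P(A)|) CQ) => A /existsP[f].
case/andP=> FQA /eqP fQA maxA.
have gA : group_set A by rewrite -fQA (fus_group_im FQA).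
exists (Group gA), f; split=> // B [g [FBA gBA]]; apply: maxA => /=.
have [h [FAB gK _]] := fus_inv FBA; move: gBA FAB => /= gBA; rewrite gBA => FAB.
apply/existsP; exists (comp_hom h f); rewrite (fus_comp FQA FAB) /=.
rewrite (eq_imset _ (ffunE _)) (imset_comp h f) fQA -gBA.
by rewrite -imset_comp (eq_in_imset (g := id)) ?imset_id.
Qed.

(** Transported along [f], the p-group [B] lands in Aut_F(R); Sylow's theorem conjugates it into
    Aut_P(R) by some [c], and [g] is [f] followed by [c]. *)
Lemma fus_Sylow_conj (p : nat) Q R (B : {group {perm gT}}) f :
    F Q R f -> f @: Q = R ->
    p.-Sylow(AutF F R) (conj_aut R @* 'N_P(R)) ->
    B \subset AutF F Q -> p.-group B ->
  exists g, [/\ F Q R g, g @: Q = R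
    & {in B, forall b : {perm gT}, exists2 y, y \in 'N_P(R)
                                & {in Q, forall x, g (b x) = g x ^ y}}].
Proof.
move=> FQR fQ sylR sBQ pB.
have sRP := fus_sub_cod FQR.
pose fm := Morphism (fus_morph FQR).
have injf : 'injm fm by apply/injmP; apply: fus_inj FQR.
have fmQ : fm @* Q = R by rewrite morphimEdom.
pose iso := Aut_isom injf (subxx Q).
have sBA := subset_trans sBQ (AutF_sub_Aut Q).
have isoE b x : b \in B -> x \in Q -> iso b (f x) = f (b x).
  by move=> Bb; apply: Aut_isomE; apply: (subsetP sBA).
have [h [FRQ fK hK]] := fus_inv FQR; rewrite fQ in FRQ hK.
pose G := Group (AutF_group_set sRP).
have sB'G : iso @* B \subset G.
  apply/subsetP=> _ /morphimP[b Ab Bb ->]; apply/AutFP; split.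
    by have := Aut_Aut_isom injf (subxx Q) b; rewrite fmQ.
  have /AutFP[_ Fb] := subsetP sBQ b Bb.
  apply: eq_fus (fus_comp (fus_comp FRQ Fb) FQR) _ => y Ry.
  rewrite !ffunE -[in RHS](hK y Ry) /= isoE //.
  by rewrite (fus_mem FRQ).
have [c Gc sBcS] := Sylow_Jsub (G := G) sylR sB'G (morphim_pgroup _ pB).
have /AutFP[Ac Fc] : c \in AutF F R by [].
exists (comp_hom (finfun c) f); split.
- exact: fus_comp FQR Fc.
- rewrite (eq_imset _ (ffunE _)) (imset_comp _ f) fQ.
  rewrite (eq_imset _ (ffunE _)).
  by apply: im_perm_on; case/setIdP: Ac.
move=> b Bb.
have: (iso b) ^ c \in iso @* B :^ c.
  by rewrite memJ_conjg mem_morphim ?(subsetP sBA).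
case/(subsetP sBcS)/morphimP=> y nRy NPy eq_bc; exists y => // x Qx.
have Rcfx : c (f x) \in R by rewrite (AutF_mem _ Gc) (fus_mem FQR).
by rewrite !ffunE -isoE // -(norm_conj_autE nRy Rcfx) -eq_bc permJ.
Qed.

End FusionBasics.

(** * Extension of morphisms and Sylow automizers *)

Section Saturated.

Variables (gT : finGroupType) (p : nat) (P : {group gT}) (F : fus_pred gT).
Hypotheses (pP : p.-group P) (satF : saturated p P F).
Implicit Types (Q R D : {group gT}) (f g : {ffun gT -> gT}).

Let fusF : fusion_system P F. Proof. by case: satF. Qed.

(** Brings the Sylow axiom at [P] into the form used for all subgroups. *)
Lemma AutP_conj_aut : conj_aut P @* 'N_P(P) = AutP P.
Proof.
apply/setP=> a; apply/morphimP/setIdP=> [[x nPx /setIP[Px _] ->] | [Aa]].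
  split; first exact: Aut_aut.
  apply/existsP; exists x; rewrite Px; apply/forall_inP=> y Py.
  by rewrite norm_conj_autE.
case/existsP=> x /andP[Px /forall_inP ax].
have nPx := subsetP (normG P) x Px; exists x => //; first exact/setIP.
apply: (eq_Aut Aa) => [|y Py]; first exact: Aut_aut.
by rewrite norm_conj_autE // (eqP (ax y Py)).
Qed.

(** The condition on [D] says, with conjugation on the right, that [D] lies in [N_phi]; the
    extension given by saturation is then restricted to [D]. *)
Lemma sat_extend Q D f :
    F Q P f -> fully_normalized F P (f @: Q) -> D \subset 'N_P(Q) ->
    {in D, forall x, exists2 y, y \in 'N_P(f @: Q)
                              & {in Q, forall z, f (z ^ x) = f z ^ y}} ->
  exists2 g, F D P g & {in Q, g =1 f}.
Proof.
case: satF => _ _ extF FQP fnQ sDN compatD.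
have [g [FNg gf]] := extF _ _ _ (fus_im_iso fusF FQP) erefl fnQ.
exists g => //; apply: (fus_restr fusF _ FNg); apply/subsetP=> x Dx.
have [y Ny fxy] := compatD x Dx; have NQx := subsetP sDN x Dx.
rewrite inE NQx; apply/existsP; exists y; rewrite Ny; apply/forall_inP=> z Qz.
have Qzx : z ^ x^-1 \in Q.
  by rewrite memJ_norm // groupV; case/setIP: NQx.
by rewrite -{2}(conjgKV x z) fxy // conjgK.
Qed.

(* If a p-automorphism [a] of [Q] normalizes [Aut_P(Q)], then it extends to
   [N_P(Q)], where by induction it is realized, up to an isomorphism onto a fully
   normalized subgroup, by conjugation inside [P]; the maximality of [|N_P(Q)|]
   forces the conjugating element to come from [N_P(Q)]. *)
Lemma fully_normalized_Sylow Q : Q \subset P -> fully_normalized F P Q ->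
  p.-Sylow(AutF F Q) (conj_aut Q @* 'N_P(Q)).
Proof.
have [m] := ubnP (#|P| - #|Q|)%N; elim: m Q => // m IHm Q lt_m sQP fnQ.
have [eqQP | ltQP] := eqVproper sQP.
  have -> : Q = P by apply: val_inj.
  by rewrite AutP_conj_aut; case: satF.
pose N := 'N_P(Q)%G; have sNP : N \subset P := subsetIl _ _.
have nQN : N \subset 'N(Q) := subsetIr _ _.
have ltQN : Q \proper N := nilpotent_proper_norm (pgroup_nil pP) ltQP.
have sQN := proper_sub ltQN.
pose G := Group (AutF_group_set fusF sQP); pose S := (conj_aut Q @* N)%G.
have sSG : S \subset G := AutP_sub_AutF fusF sQP.
have pS : p.-group S by apply: morphim_pgroup (pgroupS sNP pP).
have [T sylT sST] := Sylow_superset sSG pS; have pT := pHall_pgroup sylT.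
(* A proper subgroup of the p-group [T] is smaller than its normalizer, so this forces [S = T]. *)
suffices sNTS : 'N_T(S) \subset S.
  by have eqTS := nilpotent_sub_norm (pgroup_nil pT) sST sNTS; rewrite eqTS in sylT.
apply/subsetP=> a /setIP[Ta nSa]; have p_a := mem_p_elt pT Ta.
have Ga : a \in AutF F Q := subsetP (pHall_sub sylT) a Ta.
have /AutFP[Aa Fa] := Ga.
have aQ : finfun a @: Q = Q.
  by rewrite (eq_imset _ (ffunE _)); apply: im_perm_on; case/setIdP: Aa.
have [||x Nx|g FNP ga] := @sat_extend Q N (finfun a) _ _ (subxx _).
- exact: (fus_codP fusF Fa).
- by rewrite aQ.
- have: conj_aut Q x ^ a \in S.
    by rewrite memJ_norm // mem_morphim ?(subsetP nQN).
  case/morphimP=> y nQy Ny eq_xy; exists y; first by rewrite aQ.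
  move=> z Qz; have nQx := subsetP nQN x Nx.
  have Qaz : a z \in Q by rewrite (AutF_mem _ Ga).
  by rewrite !ffunE -(norm_conj_autE nQy Qaz) -eq_xy permJ norm_conj_autE.
have gQ : g @: Q = Q by rewrite -[RHS]aQ; apply: eq_in_imset.
have gN : g @: N \subset N.
  have := fus_norms fusF sQN nQN FNP.
  by rewrite gQ [_ \subset N]subsetI (fus_im fusF FNP).
have [b Gb bg] := AutF_of_fus fusF FNP gN.
have nQb : b \in 'N(Q | 'P).
  rewrite !inE; apply/subsetP=> z Qz; rewrite !inE /= apermE.
  by rewrite bg ?(subsetP sQN) // -gQ imset_f.
have resb : restr_perm Q b = a.
  have Ab : b \in Aut N by case/AutFP: Gb.
  apply: (eq_Aut (Aut_restr_perm sQN Ab) Aa) => z Qz.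
  by rewrite restr_permE // bg ?(subsetP sQN) // ga // ffunE.
(* [b] need not be a p-element, but its p-part still restricts to the p-element [a]. *)
pose c := b.`_p; have cb : c \in <[b]> := mem_cycle b _.
pose GN := Group (AutF_group_set fusF sNP).
have Gc : c \in GN by rewrite (subsetP _ c cb) // cycle_subG.
have nQc : c \in 'N(Q | 'P) by rewrite groupX.
have ca : {in Q, c =1 a}.
  have <- : restr_perm Q c = a by rewrite morph_constt //= resb constt_p_elt.
  by move=> z Qz; rewrite restr_permE.
have [R [t [FNR tN fnR]]] := fully_normalized_exists fusF sNP.
have cardR : #|R| = #|N| by rewrite -tN (card_fus_im fusF FNR).
have sylR : p.-Sylow(AutF F R) (conj_aut R @* 'N_P(R)).
  apply: IHm fnR; last exact: (fus_sub_cod fusF FNR).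
  rewrite cardR (leq_trans _ (ltnSE lt_m)) //.
  by rewrite ltn_sub2l ?proper_card.
have [||u [FNu uN cu]] := fus_Sylow_conj fusF FNR tN sylR (B := <[c]>%G).
- by rewrite -[AutF F N]/(gval GN) cycle_subG.
- exact: p_elt_constt.
have [y NRy ucy] := cu c (cycle_id c).
(* [u] carries [N] onto [R], which thus normalizes [u(Q)]; as [Q] is fully normalized, the
   normalizer of [u(Q)] in [P] is no larger than [R]. *)
have uNy : R :=: 'N_P(u @: Q).
  apply/eqP; rewrite eqEcard subsetI (fus_sub_cod fusF FNR).
  rewrite -{1}uN (fus_norms fusF sQN nQN FNu) cardR /=.
  exact/fnQ/(fus_iso_im fusF (fus_restr fusF sQN FNu)).
(* Since [c] preserves [Q], [y] normalizes [u(Q)]; it is then the image of some [x] in [N], and [a]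
   is conjugation by [x]. *)
have: y \in R.
  rewrite uNy inE (subsetP _ y NRy) ?subsetIl //= inE.
  apply/subsetP=> _ /imsetP[_ /imsetP[z Qz ->] ->].
  by rewrite -ucy ?(subsetP sQN) // imset_f // ca // (AutF_mem _ Ga).
rewrite -uN => /imsetP[x Nx def_y]; have nQx := subsetP nQN x Nx.
apply/morphimP; exists x => //; apply: (eq_Aut Aa) => [|z Qz]; first exact: Aut_aut.
have Nz := subsetP sQN z Qz.
rewrite norm_conj_autE // -ca //; apply: (fus_inj fusF FNu).
- by rewrite (AutF_mem _ Gc).
- by rewrite groupJ.
by rewrite (fusJ fusF FNu) // ucy // def_y.
Qed.

End Saturated.

(** * Morphisms that extend to the product with [W] and preserve [W] *)

Section StableExtension.

Variables (gT : finGroupType) (P : {group gT}) (F : fus_pred gT).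
Variable W : {group gT}.
Hypotheses (fusF : fusion_system P F) (sWZ : W \subset 'Z(P)).
Implicit Types (Q R D : {group gT}) (f g : {ffun gT -> gT}).

(** The target is [P] rather than a product with [W]: [stable_ext_im] computes the image, so the
    target can be cut down later. *)
Definition stable_ext (A : {set gT}) (f : {ffun gT -> gT}) :=
  exists g, [/\ F (W * A) P g, {in A, g =1 f} & g @: W = W].

Let sWP : W \subset P := subset_trans sWZ (center_sub P).

Lemma cent_join_sub Q : Q \subset P -> W <*> Q = W * Q.
Proof.
move=> sQP; apply: cent_joinEr.
by rewrite centsC (subset_trans sWZ) // subIset // (centS sQP) orbT.
Qed.

Lemma eq_stable_ext A f g : stable_ext A f -> {in A, f =1 g} -> stable_ext A g.
Proof.
by case=> h [FWA hf hW] fg; exists h; split=> // x Ax; rewrite hf ?fg.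
Qed.

Lemma stable_ext_restr Q D f :
  Q \subset D -> D \subset P -> stable_ext D f -> stable_ext Q f.
Proof.
move=> sQD sDP [h [FWD hf hW]]; exists h; split=> //.
  have <- := cent_join_sub (subset_trans sQD sDP).
  by apply: (fus_restr fusF _ FWD); rewrite -cent_join_sub // genS ?setUS.
by move=> x Qx; rewrite hf ?(subsetP sQD).
Qed.

Lemma stable_ext_im Q f g : Q \subset P ->
    F (W * Q) P g -> {in Q, g =1 f} -> g @: W = W ->
  g @: (W * Q) = W * f @: Q.
Proof.
move=> sQP FWQ gf gW; move: FWQ; rewrite -cent_join_sub // => FWQ.
pose gm := Morphism (fus_morph fusF FWQ).
have sW : W \subset W <*> Q := joing_subl _ _.
have sQ : Q \subset W <*> Q := joing_subr _ _.
transitivity (gm @* (W * Q)).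
  by rewrite -cent_join_sub // morphimEdom.
rewrite morphimMl // !(morphimEsub gm) //= gW; congr (_ * _).
exact: eq_in_imset.
Qed.

Lemma stable_ext_comp Q f g :
    F Q P f -> stable_ext Q f -> stable_ext (f @: Q) g ->
  stable_ext Q (comp_hom g f).
Proof.
move=> FQP [f' [FWQ f'f f'W]] [g' [FWfQ g'g g'W]].
have f'WQ := stable_ext_im (fus_sub_dom fusF FQP) FWQ f'f f'W.
exists (comp_hom g' f'); split.
- by apply: (fus_comp fusF) FWfQ; rewrite -f'WQ; apply: (fus_im_iso fusF FWQ).
- by move=> x Qx; rewrite !ffunE f'f // g'g ?imset_f.
by rewrite (eq_imset _ (ffunE _)) (imset_comp g') f'W.
Qed.

Lemma stable_ext_inv Q f g :
    F Q P f -> stable_ext Q f -> {in Q, cancel f g} ->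
  stable_ext (f @: Q) g.
Proof.
move=> FQP [f' [FWQ f'f f'W]] fK.
have sQP := fus_sub_dom fusF FQP.
have f'WQ := stable_ext_im sQP FWQ f'f f'W.
have [h [FWfQ f'K _]] := fus_inv fusF FWQ.
rewrite -cent_join_sub // in f'K.
exists h; split.
- by rewrite -f'WQ; apply: (fus_codP fusF FWfQ).
- move=> _ /imsetP[x Qx ->]; rewrite -f'f // f'K ?f'f ?fK //.
  by rewrite (subsetP (joing_subr _ _)).
rewrite -{1}f'W -imset_comp -[RHS]imset_id; apply: eq_in_imset => x Wx.
by rewrite /= f'K // (subsetP (joing_subl _ _)).
Qed.

Lemma normal_in_F_stable_ext :
  (forall Q f, F Q P f -> stable_ext Q f) -> normal_in_F F P W.
Proof.
move=> extF; have nWP : P \subset 'N(W).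
  by rewrite cents_norm // centsC (subset_trans sWZ) // subsetIr.
split=> // [|A1 A2 f FA12]; first exact: groupP.
have gA1 := fus_group_dom fusF FA12; have sA1 := fus_sub_dom fusF FA12.
have sA2 := fus_sub_cod fusF FA12.
have gA2 : group_set A2 by case: fusF => ax _ _ _ _; case: (ax _ _ _ FA12).
have [g [FWA gf gW]] := extF (Group gA1) f (fus_codP fusF FA12).
exists g; split=> //.
have WA2 := @cent_join_sub (Group gA2) sA2.
rewrite -[W * A2]WA2; apply: (fus_cod fusF FWA).
  rewrite (@stable_ext_im (Group gA1) f) //= -[W <*> A2]/(W <*> Group gA2) WA2.
  by rewrite mulgS // (fus_im fusF FA12).
by rewrite join_subG sWP.
Qed.

End StableExtension.

(** * Stability of the p^n-th powers of the centre *)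

Section MhoCenter.

Variables (gT : finGroupType) (p n : nat) (P : {group gT}) (F : fus_pred gT).
Hypotheses (p_pr : prime p) (pP : p.-group P) (satF : saturated p P F).
Hypothesis classP : nil_class P <= n * (p - 1) + 1.
Implicit Types (Q R D : {group gT}) (f g : {ffun gT -> gT}).

Let fusF : fusion_system P F. Proof. by case: satF. Qed.

(** [m] successive commutators with [x] lead into ['L_(m.+1)(P)], trivial as soon as [m] reaches the
    class. *)
Lemma iter_commg_class x a :
  x \in P -> a \in P -> iter (n * (p - 1) + 1) (fun b => [~ b, x]) a = 1.
Proof.
move=> Px Pa; have /(lcn_nil_classP _ (pgroup_nil pP)) L1 := classP.
apply/set1gP; rewrite -L1.
elim: (_ + _)%N => [|m IHm]; first by rewrite lcn1.
by rewrite iterS lcnSn mem_commg.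
Qed.

(** [Q] is smaller than its normalizer in [P]; Cauchy's theorem in the quotient gives [x]. *)
Lemma exists_norm_order_p Q : Q \proper P ->
  exists x, [/\ x \in 'N_P(Q), x \notin Q & x ^+ p \in Q].
Proof.
move=> ltQP; have ltQN := nilpotent_proper_norm (pgroup_nil pP) ltQP.
set N := 'N_P(Q) in ltQN.
have nQN : N \subset 'N(Q) := subsetIr _ _.
have pNQ : p.-group (N / Q) by rewrite quotient_pgroup ?(pgroupS (subsetIl _ _)).
have ntNQ : N / Q != 1 by rewrite -subG1 quotient_sub1 // proper_subn.
have [_ p_dv _] := pgroup_pdiv pNQ ntNQ.
have [_ /morphimP[x nQx Nx ->] ox] := Cauchy p_pr p_dv.
exists x; split=> //.
  apply/negP=> Qx; have := prime_gt1 p_pr.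
  by rewrite -ox /= coset_id ?order1.
by apply: coset_idr; rewrite ?groupX // morphX // -ox expg_order.
Qed.

(** The class bound enters here, through the unipotent action of [x] on ['Z(Q)], where [x ^+ p] acts
    trivially. *)
Lemma Mho_center_commute Q x :
    Q \subset P -> x \in 'N_P(Q) -> x ^+ p \in Q ->
  {in 'Mho^n('Z(Q)), forall v, commute v x}.
Proof.
move=> sQP /setIP[Px nQx] Qxp v.
have sZP : 'Z(Q) \subset P := subset_trans (center_sub Q) sQP.
rewrite (MhoEabelian _ (pgroupS sZP pP) (center_abelian Q)).
case/imsetP=> a Za ->; have abZ : abelian 'Z(Q)%G := center_abelian Q.
have nZx : x \in 'N('Z(Q)%G).
  exact: (subsetP (char_norms (center_char Q)) x nQx).
have cZxp : x ^+ p \in 'C('Z(Q)%G).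
  by apply: subsetP Qxp; rewrite centsC subsetIr.
have uZ : {in 'Z(Q)%G, forall b, iter (n * (p - 1) + 1) (fun c => [~ c, x]) b = 1}.
  by move=> b Zb; apply: (iter_commg_class Px); apply: (subsetP sZP).
exact: (cent_expn_of_iter_commg p_pr abZ nZx cZxp uZ).
Qed.

Local Notation W := 'Mho^n('Z(P))%G.
Let sWZ : W \subset 'Z(P) := Mho_sub n _.

(** Start of the induction: [f] is an automorphism of [P], in which [W] is characteristic. *)
Lemma stable_ext_whole f : F P P f -> stable_ext P F W P f.
Proof.
move=> FPP; have sWP := subset_trans sWZ (center_sub P).
pose fm := Morphism (fus_morph fusF FPP).
have injf : 'injm fm by apply/injmP; apply: (fus_inj fusF FPP).
have fP : fm @* P = P.
  apply/eqP; rewrite eqEcard card_injm // leqnn andbT morphimEdom.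
  exact: (fus_im fusF FPP).
exists f; split=> //; first by rewrite mulSGid.
have /charP[_ /(_ fm injf fP)] : W \char P.
  exact: char_trans (Mho_char n _) (center_char P).
by rewrite (morphimEsub fm).
Qed.

(* The kernel [K] of the action of [Aut_F(R)] on the p^n-th powers of ['Z(R)]
   contains the conjugation by some element of ['N_P(R)] outside [R], so that
   the normalizer of a Sylow subgroup of [K], a supplement to [K] by the Frattini
   argument, consists of automorphisms extending to a larger subgroup. *)
Lemma stable_ext_AutF R a :
    R \proper P -> fully_normalized F P R -> a \in AutF F R ->
    (forall D f g, R \proper D -> F D P g -> {in R, g =1 f} ->
       stable_ext P F W R f) ->
  stable_ext P F W R (finfun a).
Proof.
move=> ltRP fnR Ga ext; have sRP := proper_sub ltRP.
have imR b : b \in AutF F R -> finfun b @: R = R.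
  case/AutFP=> /setIdP[Rb _] _.
  by rewrite (eq_imset _ (ffunE _)) (im_perm_on Rb).
have FRP b : b \in AutF F R -> F R P (finfun b).
  by case/AutFP=> _ Fb; apply: (fus_codP fusF Fb).
(* If [C_P(R)] is not inside [R], then [a] extends to [R C_P(R)]: an element [r c] acts on [R] as
   [r] does, so [a r] is the matching element. *)
have [sCR | nsCR] := boolP ('C_P(R) \subset R); last first.
  have sDP : R <*> 'C_P(R) \subset P by rewrite join_subG sRP subsetIl.
  have nRC : 'C_P(R) \subset 'N(R) by rewrite subIset ?cent_sub ?orbT.
  have [||x Dx|g FDP ga] := @sat_extend _ p _ _ satF R (R <*> 'C_P(R)) _ (FRP a Ga).
  - by rewrite imR.
  - by rewrite subsetI sDP join_subG normG.
  - move: Dx; rewrite /= norm_joinEr //= => /mulsgP[r c Rr /setIP[_ cRc] ->].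
    have Rar : a r \in R by rewrite (AutF_mem _ Ga).
    exists (finfun a r).
      rewrite imR // ffunE inE (subsetP sRP) //=.
      exact: subsetP (normG R) _ _.
    move=> z Rz; rewrite conjgM -(fusJ fusF (FRP a Ga)) //; congr (_ _).
    by apply/conjg_fixP/commgP/commute_sym/(centP cRc); rewrite groupJ.
  apply: (ext _ _ g _ FDP ga).
  by rewrite properE joing_subl join_subG subxx.
pose V := 'Mho^n('Z(R)); pose G := Group (AutF_group_set fusF sRP).
have charV : V \char R by apply: char_trans (Mho_char n _) (center_char R).
have sVR := char_sub charV.
have sWV : W \subset V.
  apply: MhoS; rewrite subsetI (subset_trans _ sCR) ?setIS ?centS //=.
  by rewrite subIset // centS ?orbT.
have nVG : G \subset 'N(V | 'P).
  apply/subsetP=> b /AutFP[Ab _]; rewrite !inE; apply/subsetP=> v Vv.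
  rewrite inE /= apermE.
  have /charP[_ /(_ (autm_morphism Ab) (injm_autm Ab) (im_autm Ab))] := charV.
  rewrite (morphimEsub (autm_morphism Ab)) //= => imV.
  by rewrite -[V]imV; apply: (imset_f (autm Ab) Vv).
pose K := 'C_G(V | 'P)%G.
have nsKG : K <| G by apply: normalGI nVG (astab_normal _ _).
pose S := (conj_aut R @* 'N_P(R))%G.
have sylS : p.-Sylow(G) S := fully_normalized_Sylow pP satF sRP fnR.
have sylT := Sylow_setI_normal nsKG sylS.
have KP k : k \in K -> {in V, k =1 id}.
  by case/setIP=> _ /astabP cVk v /cVk.
(* By Frattini, [a] is [k], which fixes [V] pointwise and so is stable, followed by [b], which
   normalizes [K :&: S] and will extend to [D]. *)
have: a \in K * 'N_G(K :&: S) by rewrite (Frattini_arg nsKG sylT).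
case/mulsgP=> k b Kk /setIP[Gb nTb] def_a.
have Gk : k \in AutF F R by case/setIP: Kk.
have extk : stable_ext P F W R (finfun k).
  exists (finfun k); split=> //.
    by rewrite mulSGid ?FRP // (subset_trans sWV).
  rewrite -[RHS]imset_id; apply: eq_in_imset => v Wv.
  by rewrite ffunE (KP k Kk) // (subsetP sWV).
have [x [NRx notRx Rxp]] := exists_norm_order_p ltRP.
(* The elements of [N_P(R)] acting trivially on [V]: they include [R], as [V] is central in [R], and
   also [x], which lies outside [R]. *)
pose D := ('N_P(R) :&: conj_aut R @*^-1 K)%G.
have sRNK y : y \in 'N_P(R) -> {in V, forall v, commute v y} -> y \in D.
  move=> NRy cVy; have /setIP[_ nRy] := NRy.
  rewrite inE NRy; apply/morphpreP; split=> //; apply/setIP; split.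
    by rewrite (subsetP (AutP_sub_AutF fusF sRP)) // mem_morphim.
  apply/astabP=> v Vv; rewrite /= apermE norm_conj_autE ?(subsetP sVR) //.
  by apply/conjg_fixP/commgP/cVy.
have ltRD : R \proper D.
  rewrite properE; apply/andP; split.
    apply/subsetP=> y Ry; apply: sRNK => [|v /(subsetP (Mho_sub n _)) /setIP[_ cRv]].
      by rewrite inE (subsetP sRP) // (subsetP (normG R)).
    exact: (centP cRv).
  apply: contra notRx => /subsetP-> //; apply: sRNK => //.
  exact: Mho_center_commute.
(* For [y] in [D], conjugation by [y] lies in [K :&: S], and so does its conjugate under [b]; this
   yields the required [y']. *)
have [||y Dy|g FDP gb] := @sat_extend _ p _ _ satF R D _ (FRP b Gb).
- by rewrite imR.
- exact: subsetIl.
- have /setIP[NRy /morphpreP[nRy Ky]] := Dy.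
  have : conj_aut R y ^ b \in K :&: S.
    by rewrite memJ_norm // inE Ky mem_morphim.
  case/setIP=> _ /morphimP[y' nRy' NRy' eq_y]; exists y'; first by rewrite imR.
  move=> z Rz; have Rbz : b z \in R by rewrite (AutF_mem _ Gb).
  by rewrite !ffunE -(norm_conj_autE nRy' Rbz) -eq_y permJ norm_conj_autE.
have extb := ext _ _ _ ltRD FDP gb; rewrite -(imR k Gk) in extb.
apply: eq_stable_ext (stable_ext_comp fusF sWZ (FRP k Gk) extk extb) _ => z _.
by rewrite !ffunE def_a permM.
Qed.

Lemma stable_ext_Mho_center Q f : F Q P f -> stable_ext P F W Q f.
Proof.
have [m] := ubnP (#|P| - #|Q|)%N; elim: m Q f => // m IHm Q f lt_m FQP.
have sQP := fus_sub_dom fusF FQP.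
have [eqQP | ltQP] := eqVproper sQP.
  by move: FQP; rewrite eqQP; apply: stable_ext_whole.
(* The induction hypothesis is packaged for every subgroup of the order of [Q], since other members
   of its [F]-class occur below. *)
have ext Q1 D f1 g : #|Q1| = #|Q| -> Q1 \proper D -> F D P g ->
    {in Q1, g =1 f1} -> stable_ext P F W Q1 f1.
  move=> eqQ1 ltQ1D FDP gf; have sDP := fus_sub_dom fusF FDP.
  apply: eq_stable_ext _ gf.
  apply: (stable_ext_restr fusF sWZ (proper_sub ltQ1D) sDP).
  have ltQD : #|Q| < #|D| by rewrite -eqQ1 proper_card.
  apply: IHm FDP; rewrite (leq_trans _ (ltnSE lt_m)) //.
  by rewrite ltn_sub2l // proper_card.
have [R [t [FQR tQ fnR]]] := fully_normalized_exists fusF sQP.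
have cardR : #|R| = #|Q| by rewrite -tQ (card_fus_im fusF FQR).
have sRP := fus_sub_cod fusF FQR.
have ltP Q1 : #|Q1| = #|Q| -> Q1 \subset P -> Q1 \proper P.
  by move=> eqQ1 sQ1P; rewrite properEcard sQ1P eqQ1 proper_card.
have sylR := fully_normalized_Sylow pP satF sRP fnR.
(* [f1] is [u] followed by an automorphism [a] of [R], where [u] carries Aut_P(Q1) into Aut_P(R) and
   hence extends to [N_P(Q1)]. *)
have extR Q1 f1 : F Q1 R f1 -> f1 @: Q1 = R -> stable_ext P F W Q1 f1.
  move=> FQ1R f1Q1; have sQ1P := fus_sub_dom fusF FQ1R.
  have eqQ1 : #|Q1| = #|Q| by rewrite -cardR -f1Q1 (card_fus_im fusF FQ1R).
  have ltQ1P := ltP _ eqQ1 sQ1P.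
  have [||u [FQ1u uQ1 Nu]] := fus_Sylow_conj fusF FQ1R f1Q1 sylR
                                (B := (conj_aut Q1 @* 'N_P(Q1))%G).
  - exact: AutP_sub_AutF.
  - by rewrite morphim_pgroup ?(pgroupS (subsetIl _ _)).
  have FQ1P := fus_codP fusF FQ1u.
  have [||x NQx|g FNP gu] := @sat_extend _ p _ _ satF Q1 'N_P(Q1) u FQ1P.
  - by rewrite uQ1.
  - exact: subxx.
  - have /setIP[_ nQx] := NQx.
    have [|y NRy uy] := Nu (conj_aut Q1 x); first by rewrite mem_morphim.
    by exists y => [|z Qz]; rewrite ?uQ1 // -uy // norm_conj_autE.
  have extu : stable_ext P F W Q1 u.
    apply: ext eqQ1 _ FNP gu.
    exact: nilpotent_proper_norm (pgroup_nil pP) ltQ1P.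
  have [v [FRQ1 uK vK]] := fus_inv fusF FQ1u; rewrite uQ1 in FRQ1 vK.
  have FRR := fus_comp fusF FRQ1 FQ1R.
  have [a Ga af] := AutF_of_fus fusF FRR (fus_im fusF FRR).
  have exta : stable_ext P F W (u @: Q1) (finfun a).
    rewrite uQ1; apply: stable_ext_AutF => // [|D f2 g2]; first exact: ltP.
    exact: ext.
  apply: eq_stable_ext (stable_ext_comp fusF sWZ FQ1P extu exta) _ => x Qx.
  by rewrite !ffunE af ?(fus_mem fusF FQ1u) // ffunE uK.
(* Factor [f] as [t] followed by [f t^-1]; the latter is inverse to the isomorphism [s] onto [R], so
   [extR] handles both factors. *)
have [t' [FRQ tK _]] := fus_inv fusF FQR; rewrite tQ in FRQ.
have FRP := fus_comp fusF FRQ FQP.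
have [s [FsR s'K sK]] := fus_inv fusF FRP.
have FsRP := fus_codP fusF FsR.
pose Q1 := Group (fus_group_dom fusF FsR).
have sQ1 : s @: Q1 = R.
  rewrite /= -imset_comp -[RHS]imset_id; apply: eq_in_imset => x Rx.
  by rewrite [LHS]s'K.
have exts : stable_ext P F W R (comp_hom f t').
  have := @stable_ext_inv _ _ _ _ fusF sWZ Q1 s (comp_hom f t') FsRP.
  by rewrite sQ1; apply=> //; apply: extR.
rewrite -tQ in exts; have FQP_t := fus_codP fusF FQR.
apply: eq_stable_ext (stable_ext_comp fusF sWZ FQP_t (extR Q t FQR tQ) exts) _.
by move=> x Qx; rewrite !ffunE tK.
Qed.

End MhoCenter.

Theorem theorem1p1 (gT : finGroupType) (p n : nat) (P : {group gT})
    (F : fus_pred gT) :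
  prime p -> p.-group P -> P :!=: 1 ->
  (nil_class P <= n * (p - 1) + 1)%N ->
  saturated p P F ->
  (* O_p(F) = 1: every subgroup of P normal in F is trivial *)
  (forall W : {group gT}, normal_in_F F P W -> W :=: 1) ->
  (exponent 'Z(P) <= p ^ n)%N.
Proof.
move=> p_pr pP _ classP satF Op1; have [fusF _ _] := satF.
have pZ : p.-group 'Z(P) := pgroupS (center_sub P) pP.
have W1 : 'Mho^n('Z(P)) = 1.
  apply: (Op1 'Mho^n('Z(P))%G).
  apply: (normal_in_F_stable_ext fusF (Mho_sub n _)) => Q f.
  exact: (stable_ext_Mho_center p_pr pP satF classP).
apply: dvdn_leq; first by rewrite expn_gt0 prime_gt0.
apply/exponentP=> z Zz; apply/set1gP; rewrite -W1.
exact: Mho_p_elt Zz (mem_p_elt pZ Zz).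
Qed.
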